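(* For every cake-division instance with $n$ agents whose social graph is a line $a_1 - a_2 - \cdots - a_n$, there exists a discrete cake-cutting protocol in the Robertson–Webb query model that computes a locally envy-free allocation using at most $n^{(1+o(1))n}$ queries.
   Context: The cake is $[0,1]$. Each agent $a_i$ has a valuation $v_i$ on finite unions of subintervals of $[0,1]$ that is non-negative, additive on disjoint pieces, non-atomic (for any $[x,y]$ and $\lambda\in[0,1]$ there is $y'$ with $v_i(x,y')=\lambda v_i(x,y)$), and normalized ($v_i(0,1)=1$). An allocation is a collection $\{A_1,\dots,A_n\}$ of pairwise disjoint pieces (each a finite union of intervals) whose union is $[0,1]$, with $A_i$ given to $a_i$. Given an undirected social graph $G$ on the agents, an allocation is locally envy-free if $v_i(A_i)\ge v_i(A_j)$ for every edge $(i,j)$ of $G$. In the Robertson–Webb query model the protocol accesses valuations only through cut queries $\texttt{cut}_i(x,\tau)$ (returns $y$ with $v_i(x,y)=\tau$) and evaluation queries $\texttt{eval}_i(x,y)$ (returns $v_i(x,y)$); the query complexity counts these queries. The line graph has edges $(a_i,a_{i+1})$ for $i=1,\dots,n-1$. *)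

(* Defs.v *)
From Stdlib Require Import Reals List Sorted Arith.
Import ListNotations.
Open Scope R_scope.

(** Agents are indexed 0 .. n-1.  A valuation profile is [v : nat -> R -> R -> R],
    where [v i x y] is the value agent [i] gives to the interval [x,y]
    (0 <= x <= y <= 1).  Values of finite unions of intervals are obtained by
    additivity (see [piece_val]). *)
Definition is_valuation (f : R -> R -> R) : Prop :=
  (forall x y, 0 <= x -> x <= y -> y <= 1 -> 0 <= f x y) /\
  (forall x y z, 0 <= x -> x <= y -> y <= z -> z <= 1 -> f x z = f x y + f y z) /\
  (forall x y lam, 0 <= x -> x <= y -> y <= 1 -> 0 <= lam -> lam <= 1 ->
      exists y', x <= y' /\ y' <= y /\ f x y' = lam * f x y) /\
  f 0 1 = 1.

(** An allocation is given by cut points [0 = c_0 <= c_1 <= ... <= c_m = 1]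
    and, for each segment [c_k, c_{k+1}], its owner.  Agent j's piece A_j is
    the (finite) union of the segments it owns; the pieces are pairwise
    disjoint (up to endpoints) and cover [0,1]. *)
Definition valid_allocation (n : nat) (cuts : list R) (owners : list nat) : Prop :=
  length cuts = S (length owners) /\
  nth 0 cuts 0 = 0 /\ last cuts 0 = 1 /\
  Sorted Rle cuts /\
  Forall (fun j => (j < n)%nat) owners.

Fixpoint piece_val (f : R -> R -> R) (j : nat) (cuts : list R) (owners : list nat) : R :=
  match owners, cuts with
  | o :: os, a :: ((b :: _) as cs) =>
      (if Nat.eqb o j then f a b else 0) + piece_val f j cs os
  | _, _ => 0
  end.

Definition locally_envy_free (n : nat) (G : nat -> nat -> Prop)
    (v : nat -> R -> R -> R) (cuts : list R) (owners : list nat) : Prop :=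
  forall i j, (i < n)%nat -> (j < n)%nat -> G i j ->
    piece_val (v i) i cuts owners >= piece_val (v i) j cuts owners.

Definition line_graph (i j : nat) : Prop := j = S i \/ i = S j.

(** Protocols in the Robertson-Webb model: decision trees whose internal nodes
    are cut / eval queries (the continuation receives the oracle's answer) and
    whose leaves output an allocation. *)
Inductive protocol : Type :=
| Output (cuts : list R) (owners : list nat)
| CutQ (i : nat) (x tau : R) (k : R -> protocol)
| EvalQ (i : nat) (x y : R) (k : R -> protocol).

(** [succeeds n G v P b]: on the instance [v] with [n] agents, every execution
    of [P] (for every admissible oracle answer to cut queries) issues only
    well-posed queries, uses at most [b] queries, and outputs a locally
    envy-free allocation for graph [G]. *)
Inductive succeeds (n : nat) (G : nat -> nat -> Prop) (v : nat -> R -> R -> R)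
  : protocol -> nat -> Prop :=
| succ_out : forall cuts owners b,
    valid_allocation n cuts owners ->
    locally_envy_free n G v cuts owners ->
    succeeds n G v (Output cuts owners) b
| succ_cut : forall i x tau k b,
    (i < n)%nat -> 0 <= x -> x <= 1 ->
    (exists y, x <= y /\ y <= 1 /\ v i x y = tau) ->
    (forall y, x <= y -> y <= 1 -> v i x y = tau -> succeeds n G v (k y) b) ->
    succeeds n G v (CutQ i x tau k) (S b)
| succ_eval : forall i x y k b,
    (i < n)%nat -> 0 <= x -> x <= y -> y <= 1 ->
    succeeds n G v (k (v i x y)) b ->
    succeeds n G v (EvalQ i x y k) (S b).

(* Main.v *)
(** The cake is shared among the agents [0 .. k] of a prefix of the line with agent [k] receiving
    [W] bundles, all of equal value to [k], each at least as good for [k] as the share of [k-1] and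
    none better for [k-1] than its own share; the theorem is the case [k = n-1], [W = 1].  To go
    from [k] to [k+1], share the cake among [0 .. k] with [W+1] bundles for agent [k].  Agent [k+1]
    leaves the bundle it likes least to [k] and trims the other [W] to a common value; the trimmings
    are the residue, to which the same is applied again.  As [k] values its bundles equally, each
    round shrinks the residue by a factor [W/(W+1)] for [k].  As [k+1] values the trimmed bundles
    equally, it may add them to its [W] bundles in any order: in round [j < W] bundle [j] receives
    the most heavily trimmed one, which makes [k] prefer its own share to bundle [j] by [1/W] of the
    residue of that round.  After [O(W log n)] further rounds this margin exceeds the whole residue,
    which [k+1] can then divide into [W] equal parts.  Multiplying the numbers of rounds for
    [W = 1 .. n] gives [n^((1+o(1))n)]. *)

Require Import Defs.
From Stdlib Require Import Reals Lra Lia List Permutation Sorted Arith ClassicalEpsilon.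
Import ListNotations.
Open Scope R_scope.

(** * Pieces of cake as lists of intervals with known values *)

(* An interval with its value for every agent, so that comparing pieces costs no query. *)
Record atom := Atom { lo : R; hi : R; val : nat -> R }.
Notation piece := (list atom).

Definition pv (i : nat) (l : piece) : R := fold_right (fun a s => val a i + s) 0 l.

Fixpoint tiling (x : R) (l : piece) (y : R) : Prop :=
  match l with
  | [] => x = y
  | a :: l' => lo a = x /\ tiling (hi a) l' y
  end.

(** Bundles are assembled in any order, so atoms need to cover the cake only after reordering. *)
Definition tileable (l : piece) : Prop :=
  exists l', Permutation l l' /\ tiling 0 l' 1.

Definition upd {T} (F : nat -> T) (m : nat) (c : T) : nat -> T :=
  fun j => if Nat.eqb j m then c else F j.

Fixpoint cat (m : nat) (F : nat -> piece) : piece :=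
  match m with
  | O => []
  | S m' => cat m' F ++ F m'
  end.

Definition swap (a b i : nat) : nat :=
  if Nat.eqb i a then b else if Nat.eqb i b then a else i.

(** The range [0 .. m] is inclusive, so [argmin f w] searches all [S w] bundles. *)
Fixpoint argmin (f : nat -> R) (m : nat) : nat :=
  match m with
  | O => O
  | S m' => let i := argmin f m' in if Rlt_dec (f m) (f i) then m else i
  end.

Fixpoint eval_agents (m : nat) (x y : R) (kont : (nat -> R) -> protocol) : protocol :=
  match m with
  | O => kont (fun _ => 0)
  | S m' => EvalQ m' x y (fun r => eval_agents m' x y (fun f => kont (upd f m' r)))
  end.

(** * Updates, transpositions and concatenations of indexed families *)

Lemma upd_eq {T} (F : nat -> T) m c : upd F m c m = c.
Proof. unfold upd; now rewrite Nat.eqb_refl. Qed.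

Lemma upd_neq {T} (F : nat -> T) m c j : j <> m -> upd F m c j = F j.
Proof. unfold upd; intros H; now destruct (Nat.eqb_spec j m). Qed.

Lemma swap_l a b : swap a b a = b.
Proof. unfold swap; now rewrite Nat.eqb_refl. Qed.

Lemma swap_r a b : swap a b b = a.
Proof. unfold swap; rewrite Nat.eqb_refl. now destruct (Nat.eqb_spec b a). Qed.

Lemma swap_lt a b i m : (a < m)%nat -> (b < m)%nat -> (i < m)%nat -> (swap a b i < m)%nat.
Proof. unfold swap; now destruct (Nat.eqb i a), (Nat.eqb i b). Qed.

Lemma swap_swap a b i : swap a b (swap a b i) = i.
Proof.
  unfold swap; destruct (Nat.eqb_spec i a) as [->|Ha].
  - destruct (Nat.eqb_spec b a) as [->|]; auto. now rewrite Nat.eqb_refl.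
  - destruct (Nat.eqb_spec i b) as [->|Hb].
    + now rewrite Nat.eqb_refl.
    + destruct (Nat.eqb_spec i a), (Nat.eqb_spec i b); congruence.
Qed.

Lemma argmin_spec f m : (argmin f m <= m)%nat /\ forall j, (j <= m)%nat -> f (argmin f m) <= f j.
Proof.
  induction m as [|m [IH1 IH2]]; simpl.
  - split; auto. intros j Hj; replace j with 0%nat by lia; lra.
  - destruct (Rlt_dec (f (S m)) (f (argmin f m))) as [H|H]; split; auto; intros j Hj;
      (destruct (Nat.eq_dec j (S m)) as [->|]; [lra|]);
      assert (f (argmin f m) <= f j) by (apply IH2; lia); lra.
Qed.

Lemma cat_ext m F G : (forall j, (j < m)%nat -> F j = G j) -> cat m F = cat m G.
Proof. induction m as [|m IH]; intros H; simpl; auto. rewrite IH, H; auto. Qed.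

Lemma cat_flat_map m F : cat m F = flat_map F (seq 0 m).
Proof.
  induction m as [|m IH]; auto. rewrite seq_S, flat_map_app, <- IH. simpl.
  now rewrite app_nil_r.
Qed.

Ltac perm :=
  rewrite <- ?app_assoc;
  do 60 (try first [ apply Permutation_refl | apply Permutation_app_head
    | eapply Permutation_trans; [|apply Permutation_app_comm]; rewrite <- ?app_assoc ]).

Lemma cat_app m F G : Permutation (cat m (fun i => F i ++ G i)) (cat m F ++ cat m G).
Proof.
  induction m as [|m IH]; simpl; auto.
  eapply Permutation_trans; [apply Permutation_app_tail, IH|]. perm.
Qed.

(** The transposed indices are again a duplicate-free enumeration of those below [m], hence a
    permutation of [seq 0 m]. *)
Lemma cat_swap a b m F : (a < m)%nat -> (b < m)%nat ->
  Permutation (cat m (fun i => F (swap a b i))) (cat m F).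
Proof.
  intros Ha Hb. rewrite !cat_flat_map.
  replace (flat_map (fun i => F (swap a b i)) (seq 0 m))
    with (flat_map F (map (swap a b) (seq 0 m))).
  - apply Permutation_flat_map. apply NoDup_Permutation.
    + apply FinFun.Injective_map_NoDup; [|apply seq_NoDup].
      intros x y E. rewrite <- (swap_swap a b x), E. apply swap_swap.
    + apply seq_NoDup.
    + intros x. rewrite in_map_iff. setoid_rewrite in_seq. split.
      * intros (y & <- & Hy). pose proof (swap_lt a b y m Ha Hb). lia.
      * intros Hx. exists (swap a b x). split; [apply swap_swap|].
        pose proof (swap_lt a b x m Ha Hb). lia.
  - generalize (seq 0 m) as s; induction s; simpl; congruence.
Qed.

(** * The protocol, in continuation-passing style *)

Section Protocol.
Variable n : nat.

(** Takes atoms from the front until agent [i] has value [tau]. Only the atom where the target falls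
    is cut; all agents evaluate its left part, and the right part follows by additivity: at most
    [n + 1] queries. *)
Fixpoint trim (i : nat) (tau : R) (l : piece) (kont : piece * piece -> protocol) : protocol :=
  match l with
  | [] => kont ([], [])
  | a :: l' =>
      if Rle_dec (val a i) tau
      then trim i (tau - val a i) l' (fun p => kont (a :: fst p, snd p))
      else CutQ i (lo a) tau (fun z => eval_agents n (lo a) z (fun f =>
             kont ([Atom (lo a) z f], Atom z (hi a) (fun j => val a j - f j) :: l')))
  end.

Fixpoint trim_all (i : nat) (tau : R) (m : nat) (F : nat -> piece)
    (kont : (nat -> piece) * (nat -> piece) -> protocol) : protocol :=
  match m with
  | O => kont (fun _ => [], fun _ => [])
  | S m' => trim i tau (F m') (fun p => trim_all i tau m' F (fun q =>
              kont (upd (fst q) m' (fst p), upd (snd q) m' (snd p))))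
  end.

(* Produces [S m] pieces, indexed [0 .. m]. *)
Fixpoint equal_cut (i m : nat) (l : piece) (kont : (nat -> piece) -> protocol) : protocol :=
  match m with
  | O => kont (fun _ => l)
  | S m' => trim i (pv i l / INR (S m)) l (fun p =>
              equal_cut i m' (snd p) (fun F => kont (upd F m (fst p))))
  end.

(** Shares of the agents [0 .. k], bundles of agent [S k], and residue. *)
Definition state : Type := (nat -> piece) * (nat -> piece) * piece.

Definition trim_step (k w t : nat) (A D A1 B : nat -> piece) (kont : state -> protocol)
    : protocol :=
  (* The least value among the [S w] kept bundles, so that each can be trimmed down to it. *)
  let tau := pv (S k) (B (argmin (fun j => pv (S k) (B j)) w)) in
  trim_all (S k) tau (S w) B (fun CX =>
    (* Minimizing the negation selects the trimming that agent [k] values most. *)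
    let s := argmin (fun j => - pv k (snd CX j)) w in
    kont (fun i => A i ++ (if Nat.eqb i k then B (S w) else A1 i),
          fun i => D i ++ fst CX (swap t s i),
          cat (S w) (snd CX))).

Definition round (sub : piece -> ((nat -> piece) * (nat -> piece) -> protocol) -> protocol)
    (k w t : nat) (st : state) (kont : state -> protocol) : protocol :=
  let '(A, D, R0) := st in
  sub R0 (fun AB =>
    (* The transposition moves the bundle that agent [S k] likes least to the last index, which
       [trim_step] hands to agent [k]. *)
    let m := argmin (fun j => pv (S k) (snd AB j)) (S w) in
    trim_step k w t A D (fst AB) (fun i => snd AB (swap m (S w) i)) kont).

Fixpoint rounds (sub : piece -> ((nat -> piece) * (nat -> piece) -> protocol) -> protocol)
    (k w : nat) (ts : list nat) (st : state) (kont : state -> protocol) : protocol :=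
  match ts with
  | [] => kont st
  | t :: ts' => round sub k w t st (fun st' => rounds sub k w ts' st' kont)
  end.

(** A number of halvings, to be chosen with [n <= 2 ^ L]. *)
Variable L : nat.

(* Agent [k] gets [S w] bundles.  The first [S w] rounds give agent [k'] a margin over each of
   them, the others make the residue smaller than that margin. *)
Fixpoint solve (k w : nat) (l : piece) (kont : (nat -> piece) * (nat -> piece) -> protocol)
    : protocol :=
  match k with
  | O => equal_cut 0 w l (fun B => kont (fun _ => [], B))
  | S k' =>
      rounds (solve k' (S w)) k' w (seq 0 (S w)) (fun _ => [], fun _ => [], l) (fun st =>
      (* The target index is arbitrary here: these rounds serve only to shrink the residue. *)
      rounds (solve k' (S w)) k' w (repeat 0%nat (S w * L)) st (fun st' =>
      let '(A, D, R0) := st' in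
      equal_cut k w R0 (fun E => kont (A, fun i => D i ++ E i))))
  end.

Fixpoint cost (k w : nat) : nat :=
  match k with
  | O => w * S n
  | S k' => (S w + S w * L) * (cost k' (S w) + S w * S n) + w * S n
  end.

(** * Specifications with query budgets, and refinement of pieces *)

Variable v : nat -> R -> R -> R.
Hypothesis Hv : forall i, (i < n)%nat -> is_valuation (v i).

Definition wf (a : atom) : Prop :=
  0 <= lo a /\ lo a <= hi a /\ hi a <= 1 /\ forall i, (i < n)%nat -> val a i = v i (lo a) (hi a).

(** The arbitrary [rest] lets a local cut be applied inside a larger collection that covers the
    cake. *)
Definition refines (l l' : piece) : Prop :=
  (Forall wf l -> Forall wf l') /\
  (forall i, (i < n)%nat -> pv i l' = pv i l) /\
  (forall rest, tileable (l ++ rest) -> tileable (l' ++ rest)).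

(** A Hoare triple for continuation-passing code: [c] queries are charged to [proc], and [b] is the
    budget of the continuation. *)
Definition implements {X : Type} (c : nat) (proc : (X -> protocol) -> protocol)
    (Post : X -> Prop) : Prop :=
  forall kont b, (forall x, Post x -> succeeds n line_graph v (kont x) b) ->
    succeeds n line_graph v (proc kont) (c + b).

(** Needed because a procedure may stay below its budget: [trim] issues no query when it takes every
    atom whole. *)
Lemma succeeds_le P b : succeeds n line_graph v P b ->
  forall b', (b <= b')%nat -> succeeds n line_graph v P b'.
Proof.
  induction 1; intros b' Hb.
  - now constructor.
  - destruct b' as [|b']; [lia|]. constructor; auto. intros; apply H4; auto; lia.
  - destruct b' as [|b']; [lia|]. constructor; auto. apply IHsucceeds; lia.
Qed.

Lemma pv_app i l l' : pv i (l ++ l') = pv i l + pv i l'.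
Proof. induction l as [|a l IH]; simpl; [lra|rewrite IH; lra]. Qed.

Lemma pv_perm i l l' : Permutation l l' -> pv i l = pv i l'.
Proof. induction 1; simpl; lra. Qed.

Lemma pv_nonneg i l : (i < n)%nat -> Forall wf l -> 0 <= pv i l.
Proof.
  intros Hi; induction 1 as [|a l [H0 [H1 [H2 H3]]] _ IH]; simpl; [lra|].
  rewrite (H3 i Hi). destruct (Hv i Hi) as [P _]. specialize (P _ _ H0 H1 H2). lra.
Qed.

Lemma tileable_perm l l' : Permutation l l' -> tileable l -> tileable l'.
Proof.
  intros Hp (m & Hm & Ht). exists m; split; auto.
  eapply Permutation_trans; [apply Permutation_sym|]; eauto.
Qed.

Lemma refines_perm l l' : Permutation l l' -> refines l l'.
Proof.
  intros Hp; (split; [|split]).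
  - intros H; eapply Permutation_Forall; eauto.
  - intros i _; symmetry; now apply pv_perm.
  - intros rest; apply tileable_perm. now apply Permutation_app_tail.
Qed.

Lemma refines_refl l : refines l l.
Proof. now apply refines_perm. Qed.

Lemma refines_trans l1 l2 l3 : refines l1 l2 -> refines l2 l3 -> refines l1 l3.
Proof.
  intros (A1 & B1 & C1) (A2 & B2 & C2); repeat split; auto.
  intros i Hi; rewrite B2, B1; auto.
Qed.

(** Each half is refined with the other one absorbed into [rest]. *)
Lemma refines_app l1 l2 m1 m2 : refines l1 m1 -> refines l2 m2 -> refines (l1 ++ l2) (m1 ++ m2).
Proof.
  intros (A1 & B1 & C1) (A2 & B2 & C2); (split; [|split]).
  - rewrite !Forall_app; tauto.
  - intros i Hi; rewrite !pv_app, B1, B2; auto.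
  - intros rest H.
    rewrite <- app_assoc in *. apply C1 in H.
    apply (tileable_perm (m2 ++ (m1 ++ rest))).
    + apply Permutation_app_swap_app.
    + apply C2. eapply tileable_perm; [|exact H]. apply Permutation_app_swap_app.
Qed.

Lemma tiling_app x l1 l2 y : tiling x (l1 ++ l2) y <-> exists z, tiling x l1 z /\ tiling z l2 y.
Proof.
  revert x; induction l1 as [|a l1 IH]; intros x; simpl.
  - split; [intros H; exists x; auto | intros (z & -> & H); auto].
  - rewrite IH. split; [intros (H & z & H1 & H2) | intros (z & (H & H1) & H2)];
      [exists z | split; [|exists z]]; auto.
Qed.

(** The two parts take the place of [a] in whichever tiling contains it. *)
Lemma refines_split a x f :
  wf a -> lo a <= x -> x <= hi a -> (forall j, (j < n)%nat -> f j = v j (lo a) x) ->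
  refines [a] [Atom (lo a) x f; Atom x (hi a) (fun j => val a j - f j)].
Proof.
  intros (H0 & H1 & H2 & H3) Hx1 Hx2 Hf; split; [|split].
  - intros _. constructor; [|constructor; [|constructor]]; unfold wf; simpl.
    + split; [lra|split; [lra|split; [lra|auto]]].
    + split; [lra|split; [lra|split; [lra|]]].
      intros i Hi. rewrite (H3 i Hi), (Hf i Hi).
      destruct (Hv i Hi) as (_ & P & _). rewrite (P (lo a) x (hi a)); lra.
  - intros i Hi; simpl; lra.
  - intros rest (m & Hm & Ht). simpl in *.
    assert (In a m) as Hin by (eapply Permutation_in; [exact Hm | now left]).
    apply in_split in Hin as (l1 & l2 & ->).
    exists (l1 ++ Atom (lo a) x f :: Atom x (hi a) (fun j => val a j - f j) :: l2). split.
    + apply Permutation_cons_app_inv in Hm.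
      eapply Permutation_trans; [|apply Permutation_middle].
      constructor. eapply Permutation_trans; [|apply Permutation_middle]. now constructor.
    + rewrite tiling_app in *. destruct Ht as (z & T1 & T2); exists z; split; auto.
      simpl in *. tauto.
Qed.

(** * Correctness of evaluation, trimming and equal division *)

Lemma eval_agents_spec m x y : (m <= n)%nat -> 0 <= x -> x <= y -> y <= 1 ->
  implements m (eval_agents m x y) (fun f => forall j, (j < m)%nat -> f j = v j x y).
Proof.
  intros Hm Hx Hxy Hy; induction m as [|m IH]; intros kont b Hk; simpl.
  - apply Hk; lia.
  - constructor; auto. apply IH; [lia|]. intros f Hf. apply Hk. intros j Hj.
    unfold upd. destruct (Nat.eqb_spec j m); [now subst | apply Hf; lia].
Qed.

Lemma trim_spec i tau l : (i < n)%nat -> Forall wf l -> 0 <= tau -> tau <= pv i l ->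
  implements (S n) (trim i tau l) (fun p => refines l (fst p ++ snd p) /\ pv i (fst p) = tau).
Proof.
  intros Hi Hl; revert tau; induction Hl as [|a l Ha Hl IH]; intros tau H0 H1 kont b Hk; simpl in *.
  - eapply succeeds_le; [apply Hk|lia]. split; [apply refines_refl | simpl; lra].
  - destruct (Rle_dec (val a i) tau) as [Hle|Hgt].
    + apply (IH (tau - val a i)); [lra|lra|].
      intros [c x] [Hr Hp]; apply Hk; simpl in *; split; [|lra].
      apply (refines_app [a] l [a]); auto using refines_refl.
    + assert (Ha' := Ha). destruct Ha' as (L0 & L1 & L2 & L3).
      pose proof (L3 i Hi) as Lv.
      destruct (Hv i Hi) as (Pn & Pa & Pd & _).
      assert (0 <= val a i) as Hpos by (rewrite Lv; auto).
      assert (val a i <> 0) as Hnz by lra.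
      constructor; auto; [lra| |].
      (* Non-atomicity at the fraction [tau / val a i] yields a cut point inside [a]. *)
      * destruct (Pd (lo a) (hi a) (tau / val a i)) as (y & Hy1 & Hy2 & Hy3); auto.
        -- apply Rmult_le_pos; [lra|]. left; apply Rinv_0_lt_compat; lra.
        -- apply Rmult_le_reg_r with (val a i); [lra|].
           unfold Rdiv. rewrite Rmult_assoc, Rinv_l; lra.
        -- exists y; split; [|split]; [lra|lra|].
           rewrite Hy3, <- Lv. field; auto.
      * intros y Hy1 Hy2 Hy3.
        (* The oracle may return any point of the right value. One beyond [hi a] would enclose all
           of [a], whose value exceeds [tau]. *)
        assert (y <= hi a) as Hyh.
        { destruct (Rle_dec y (hi a)); auto.
          assert (v i (lo a) y = v i (lo a) (hi a) + v i (hi a) y) as E by (apply Pa; lra).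
          assert (0 <= v i (hi a) y) by (apply Pn; lra). lra. }
        apply eval_agents_spec; auto.
        intros f Hf. apply Hk. simpl. split.
        -- apply (refines_app [a] l [_; _]); auto using refines_refl, refines_split.
        -- rewrite (Hf i Hi), Hy3; lra.
Qed.

Lemma pv_cat_le i m F c : (forall j, (j < m)%nat -> pv i (F j) <= c) ->
  pv i (cat m F) <= INR m * c.
Proof.
  induction m as [|m IH]; intros H; [simpl; lra|].
  rewrite S_INR; simpl cat; rewrite pv_app.
  assert (pv i (F m) <= c) by (apply H; lia).
  assert (pv i (cat m F) <= INR m * c) by (apply IH; intros; apply H; lia). lra.
Qed.

Lemma pv_cat_eq i m F c : (forall j, (j < m)%nat -> pv i (F j) = c) ->
  pv i (cat m F) = INR m * c.
Proof.
  induction m as [|m IH]; intros H; [simpl; lra|].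
  rewrite S_INR; simpl cat; rewrite pv_app, IH, (H m); auto; lra.
Qed.

Lemma refines_cat m F G : (forall j, (j < m)%nat -> refines (F j) (G j)) ->
  refines (cat m F) (cat m G).
Proof.
  induction m as [|m IH]; intros H; simpl; [apply refines_refl|].
  apply refines_app; auto.
Qed.

Lemma Forall_cat m F j : Forall wf (cat m F) -> (j < m)%nat -> Forall wf (F j).
Proof.
  induction m as [|m IH]; simpl; [lia|]. rewrite Forall_app; intros [H1 H2] Hj.
  destruct (Nat.eq_dec j m) as [->|]; auto. apply IH; auto; lia.
Qed.

Lemma trim_all_spec i tau m F : (i < n)%nat -> 0 <= tau ->
  (forall j, (j < m)%nat -> Forall wf (F j) /\ tau <= pv i (F j)) ->
  implements (m * S n) (trim_all i tau m F)
    (fun CX => forall j, (j < m)%nat ->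
       refines (F j) (fst CX j ++ snd CX j) /\ pv i (fst CX j) = tau).
Proof.
  intros Hi H0; induction m as [|m IH]; intros HF kont b Hk.
  - apply Hk; lia.
  - destruct (HF m) as [F1 F2]; auto.
    replace (S m * S n + b)%nat with (S n + (m * S n + b))%nat by lia.
    cbn [trim_all].
    apply trim_spec; auto.
    intros [c x] Hcx. apply IH; auto. intros [C X] HCX. apply Hk. simpl in *.
    intros j Hj; destruct (Nat.eq_dec j m) as [->|].
    + now rewrite !upd_eq.
    + rewrite !upd_neq by auto. apply HCX; lia.
Qed.

(** What remains after removing one of [S (S m)] equal shares is worth [S m] such shares, so the
    recursion reproduces the same share. *)
Lemma equal_cut_spec i m l : (i < n)%nat -> Forall wf l ->
  implements (m * S n) (equal_cut i m l)
    (fun F => refines l (cat (S m) F) /\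
       forall j, (j <= m)%nat -> pv i (F j) = pv i l / INR (S m)).
Proof.
  intros Hi; revert l; induction m as [|m IH]; intros l Hl kont b Hk.
  - simpl. apply Hk. split; [apply refines_refl|]. intros; simpl; field.
  - replace (S m * S n + b)%nat with (S n + (m * S n + b))%nat by lia.
    cbn [equal_cut].
    pose proof (pv_nonneg i l Hi Hl) as Hp.
    assert (0 < INR (S m)) as Hm by (apply lt_0_INR; lia).
    assert (0 <= pv i l / INR (S (S m)) <= pv i l) as [T0 T1].
    { rewrite (S_INR (S m)). split.
      - apply Rmult_le_pos; auto. left; apply Rinv_0_lt_compat; lra.
      - apply Rmult_le_reg_r with (INR (S m) + 1); [lra|].
        unfold Rdiv; rewrite Rmult_assoc, Rinv_l by lra.
        apply Rmult_le_compat_l; lra. }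
    apply trim_spec; auto.
    intros [c x] [Hr Hc]; cbn [fst snd] in *.
    assert (Forall wf x) as Hx.
    { apply (proj1 Hr) in Hl. rewrite Forall_app in Hl; tauto. }
    assert (pv i x = pv i l - pv i l / INR (S (S m))) as Ex.
    { destruct Hr as (_ & Hr & _). specialize (Hr i Hi). rewrite pv_app in Hr. lra. }
    apply IH; auto. intros F [HF1 HF2]. apply Hk. split.
    + cbn [cat]. rewrite upd_eq.
      rewrite (cat_ext m _ F) by (intros; apply upd_neq; lia). rewrite upd_neq by lia.
      apply refines_trans with (1 := Hr).
      apply refines_trans with (x ++ c); [apply refines_perm, Permutation_app_comm|].
      apply refines_app; auto using refines_refl.
    + intros j Hj; destruct (Nat.eq_dec j (S m)) as [->|].
      * now rewrite upd_eq.
      * rewrite upd_neq, HF2, Ex by lia. rewrite (S_INR (S m)). field. split; lra.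
Qed.

(** * Envy-freeness along a prefix of the line, round by round *)

(* [X] is not yet allocated; agent [k] owns the bundles [B 0 .. B w]. *)
Definition partial (k w : nat) (l : piece) (A B : nat -> piece) (X : piece) : Prop :=
  refines l (cat k A ++ cat (S w) B ++ X) /\
  (forall i, (S i < k)%nat ->
     pv i (A (S i)) <= pv i (A i) /\ pv (S i) (A i) <= pv (S i) (A (S i))) /\
  (forall i j, S i = k -> (j <= w)%nat ->
     pv i (B j) <= pv i (A i) /\ pv k (A i) <= pv k (B j)) /\
  (forall j j', (j <= w)%nat -> (j' <= w)%nat -> pv k (B j) = pv k (B j')).

Section Round.
Variables (k w : nat) (l : piece).
Hypothesis Hk : (S k < n)%nat.
Variable c : nat.
(** Stands for the recursive call, which provides agent [k] with one bundle more than agent [S k] is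
    to receive. *)
Variable sub : piece -> ((nat -> piece) * (nat -> piece) -> protocol) -> protocol.
Hypothesis Hl : Forall wf l.
Hypothesis Hsub : forall m, Forall wf m ->
  implements c (sub m) (fun AB => partial k (S w) m (fst AB) (snd AB) []).

Definition alloc (st : state) : nat -> piece := fst (fst st).
Definition bundles (st : state) : nat -> piece := snd (fst st).
Definition residue (st : state) : piece := snd st.
Definition valid (st : state) : Prop :=
  partial (S k) w l (alloc st) (bundles st) (residue st).
(** What bundle [j] can still gain before agent [k] envies it. *)
Definition slack (st : state) (j : nat) : R := pv k (alloc st k) - pv k (bundles st j).

Lemma valid_residue st : valid st -> Forall wf (residue st).
Proof.
  intros ((H & _) & _). specialize (H Hl). rewrite !Forall_app in H; tauto.
Qed.

(* One round changes [(A, D, R0)] as follows: [sub] splits [R0] into [A1] and the bundles [B],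
   of which [B (S w)] goes to agent [k] and the others are trimmed to [C], leaving [X]. *)
Lemma round_spec t st : (t <= w)%nat -> valid st ->
  implements (c + S w * S n) (round sub k w t st) (fun st' =>
    valid st' /\
    INR (S (S w)) * pv k (residue st') <= INR (S w) * pv k (residue st) /\
    (forall j, (j <= w)%nat -> slack st j <= slack st' j) /\
    pv k (residue st') <= INR (S w) * slack st' t).
Proof.
  intros Ht Hst kont b Hkont.
  pose proof (valid_residue st Hst) as HR.
  destruct st as [[A D] R0]. unfold valid, slack, alloc, bundles, residue in *; cbn [fst snd] in *.
  cbn [round]. rewrite <- Nat.add_assoc.
  apply Hsub; auto. intros [A1 B1] (Pr & Pl & Pe & Pq); cbn [fst snd] in *.
  destruct Hst as (Sr & Sl & Se & Sq).
  destruct (argmin_spec (fun j => pv (S k) (B1 j)) (S w)) as [Am1 Am2].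
  set (m := argmin (fun j => pv (S k) (B1 j)) (S w)) in *; clearbody m.
  set (B := fun i => B1 (swap m (S w) i)) in |- *.
  assert (HB : Permutation (cat (S (S w)) B1) (cat (S w) B ++ B (S w))).
  { apply Permutation_sym. exact (cat_swap m (S w) (S (S w)) B1 ltac:(lia) ltac:(lia)). }
  assert (HBidx : forall j, (j <= S w)%nat -> (swap m (S w) j <= S w)%nat).
  { intros j Hj. pose proof (swap_lt m (S w) j (S (S w)) ltac:(lia) ltac:(lia) ltac:(lia)). lia. }
  assert (HBmin : forall j, (j <= S w)%nat -> pv (S k) (B (S w)) <= pv (S k) (B j)).
  { intros j Hj. unfold B. rewrite swap_r. auto. }
  assert (HBq : forall j j', (j <= S w)%nat -> (j' <= S w)%nat -> pv k (B j) = pv k (B j')).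
  { intros; unfold B; apply Pq; auto. }
  assert (HBe : forall i j, S i = k -> (j <= S w)%nat ->
            pv i (B j) <= pv i (A1 i) /\ pv k (A1 i) <= pv k (B j)).
  { intros; unfold B; apply Pe; auto. }
  unfold trim_step.
  destruct (argmin_spec (fun j => pv (S k) (B j)) w) as [Tm1 Tm2].
  set (tau := pv (S k) (B (argmin (fun j => pv (S k) (B j)) w))) in *.
  assert (Htau : pv (S k) (B (S w)) <= tau) by (apply HBmin; lia).
  clearbody tau B. clear m Am1 Am2 HBidx Pe Pq HBmin.
  assert (Pr' : refines R0 (cat k A1 ++ cat (S w) B ++ B (S w))).
  { apply refines_trans with (1 := Pr). apply refines_perm. rewrite app_nil_r.
    now apply Permutation_app_head. }
  assert (HBwf : Forall wf (cat (S w) B) /\ Forall wf (B (S w))).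
  { destruct Pr' as (H & _). specialize (H HR). rewrite !Forall_app in H; tauto. }
  destruct HBwf as [HBwf1 HBwf2].
  apply trim_all_spec; auto.
  { apply Rle_trans with (2 := Htau). apply pv_nonneg; auto. }
  { intros j Hj; split; [apply (Forall_cat _ _ _ HBwf1 Hj)|]. apply Tm2; lia. }
  intros [C X] HCX; cbn [fst snd] in *.
  destruct (argmin_spec (fun j => - pv k (X j)) w) as [Xm1 Xm2].
  set (s := argmin (fun j => - pv k (X j)) w) in *; clearbody s.
  assert (Hkn : (k < n)%nat) by lia.
  assert (HCXv : forall j i, (j <= w)%nat -> (i < n)%nat -> pv i (B j) = pv i (C j) + pv i (X j)).
  { intros j i Hj Hi. destruct (HCX j ltac:(lia)) as [(_ & H & _) _].
    rewrite <- pv_app. symmetry; auto. }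
  assert (HX0 : forall j i, (j <= w)%nat -> (i < n)%nat -> 0 <= pv i (X j)).
  { intros j i Hj Hi. apply pv_nonneg; auto.
    destruct (HCX j ltac:(lia)) as [(H & _) _].
    assert (Forall wf (B j)) as H' by (apply (Forall_cat _ _ _ HBwf1); lia).
    specialize (H H'). rewrite Forall_app in H; tauto. }
  assert (Hsw : forall j, (j <= w)%nat -> (swap t s j <= w)%nat).
  { intros j Hj. pose proof (swap_lt t s j (S w) ltac:(lia) ltac:(lia) ltac:(lia)). lia. }
  assert (HW : 0 < INR (S w)) by (apply lt_0_INR; lia).
  apply Hkont. cbn [fst snd].
  split; [|split; [|split]].
  - unfold partial. split; [|split; [|split]].
    + apply refines_trans with (1 := Sr).
      apply refines_trans with
        ((cat (S k) A ++ cat (S w) D) ++ cat k A1 ++ (cat (S w) C ++ cat (S w) X) ++ B (S w)).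
      * rewrite app_assoc. apply refines_app; [apply refines_refl|].
        apply refines_trans with (1 := Pr').
        apply refines_app; [apply refines_refl|]. apply refines_app; [|apply refines_refl].
        apply refines_trans with (cat (S w) (fun i => C i ++ X i)).
        -- apply refines_cat. intros j Hj. now apply HCX.
        -- apply refines_perm, cat_app.
      * apply refines_perm. apply Permutation_sym.
        eapply Permutation_trans;
          [apply Permutation_app; [|apply Permutation_app_tail; apply cat_app]|].
        { simpl cat at 1. rewrite Nat.eqb_refl. apply Permutation_app_tail.
          rewrite (cat_ext k _ (fun i => A i ++ A1 i)).
          - apply cat_app.
          - intros j Hj. destruct (Nat.eqb_spec j k); [lia|auto]. }
        eapply Permutation_trans;
          [apply Permutation_app_head, Permutation_app_tail, Permutation_app_head,
             (cat_swap t s (S w) C); lia|].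
        change (cat (S k) A) with (cat k A ++ A k).
        set (cC := cat (S w) C); set (cX := cat (S w) X); set (cD := cat (S w) D).
        perm.
    + intros i Hi. specialize (Sl i Hi).
      rewrite !pv_app. destruct (Nat.eqb_spec i k) as [->|Hik]; [lia|].
      destruct (Nat.eqb_spec (S i) k) as [E|E].
      (* Agent [k] receives one of the bundles of [sub], over which it and its predecessor have no
         envy. *)
      * destruct (HBe i (S w) E (le_n _)) as [E1 E2]. rewrite <- E in E2. lra.
      * destruct (Pl i ltac:(lia)). lra.
    (* Agent [k] values all bundles equally and gets an untrimmed one; agent [S k] gave away its
       least liked one, worth at most [tau] to it. *)
    + intros i j [= ->] Hj. rewrite Nat.eqb_refl, !pv_app.
      destruct (Se k j eq_refl Hj) as [S1 S2].
      specialize (Hsw j Hj).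
      pose proof (HCXv _ k Hsw Hkn). pose proof (HX0 _ k Hsw Hkn).
      assert (pv k (B (S w)) = pv k (B (swap t s j))) by (apply HBq; lia).
      assert (pv (S k) (C (swap t s j)) = tau) by (apply HCX; lia).
      split; lra.
    + intros j j' Hj Hj'. rewrite !pv_app, (Sq j j' Hj Hj').
      destruct (HCX (swap t s j)) as [_ ->]; [specialize (Hsw j Hj); lia|].
      destruct (HCX (swap t s j')) as [_ ->]; [specialize (Hsw j' Hj'); lia|]. lra.
  - (* [X] is part of [S w] bundles, while [R0] contains [S (S w)] bundles of equal value. *)
    set (beta := pv k (B (S w))).
    assert (HA1 : 0 <= pv k (cat k A1)).
    { apply pv_nonneg; auto. destruct Pr' as (H & _). specialize (H HR).
      rewrite !Forall_app in H; tauto. }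
    assert (E : pv k R0 = pv k (cat k A1) + (INR (S w) * beta + beta)).
    { destruct Pr' as (_ & H & _). rewrite <- (H k Hkn), !pv_app.
      rewrite (pv_cat_eq k (S w) B beta); [reflexivity|]. intros; apply HBq; lia. }
    assert (EX : pv k (cat (S w) X) <= INR (S w) * beta).
    { apply pv_cat_le. intros j Hj.
      assert (pv k (B j) = beta) by (apply HBq; lia).
      pose proof (HCXv j k ltac:(lia) Hkn).
      assert (0 <= pv k (C j)).
      { apply pv_nonneg; auto. destruct (HCX j Hj) as [(H' & _) _].
        specialize (H' (Forall_cat _ _ _ HBwf1 Hj)). rewrite Forall_app in H'; tauto. }
      lra. }
    rewrite (S_INR (S w)), E. nra.
  (* Bundle [j] gains a trimmed bundle, agent [k] an intact one that it valued equally before the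
     trimming. *)
  - intros j Hj. rewrite Nat.eqb_refl, !pv_app. specialize (Hsw j Hj).
    pose proof (HCXv _ k Hsw Hkn). pose proof (HX0 _ k Hsw Hkn).
    assert (pv k (B (S w)) = pv k (B (swap t s j))) by (apply HBq; lia). lra.
  (* Bundle [t] receives [C s], so its slack gains [pv k (X s)], the largest of the [S w]
     trimmings. *)
  - rewrite Nat.eqb_refl, !pv_app, swap_l.
    apply Rle_trans with (INR (S w) * pv k (X s)).
    + apply pv_cat_le. intros j Hj. specialize (Xm2 j ltac:(lia)). lra.
    + apply Rmult_le_compat_l; [lra|].
      destruct (Se k t eq_refl Ht) as [S1 _].
      pose proof (HCXv s k Xm1 Hkn).
      assert (pv k (B (S w)) = pv k (B s)) by (apply HBq; lia). lra.
Qed.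

(** The shrinking factors multiply. The residue never grows and no slack drops, so the margin that a
    round creates for its bundle lasts to the end. *)
Lemma rounds_spec ts st : Forall (fun t => (t <= w)%nat) ts -> valid st ->
  implements (length ts * (c + S w * S n)) (rounds sub k w ts st) (fun st' =>
    valid st' /\
    pv k (residue st') <= (INR (S w) / INR (S (S w))) ^ length ts * pv k (residue st) /\
    (forall j, (j <= w)%nat -> slack st j <= slack st' j) /\
    (forall t, In t ts -> pv k (residue st') <= INR (S w) * slack st' t)).
Proof.
  intros Hts; revert st; induction Hts as [|t ts Ht Hts IH]; intros st Hst kont b Hkont.
  - apply Hkont. split; [auto|split; [simpl; lra|split; [intros; lra|simpl; tauto]]].
  - cbn [rounds length Nat.mul]. rewrite <- Nat.add_assoc.
    apply round_spec; auto. intros st1 (V1 & R1 & S1 & T1).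
    apply IH; auto. intros st2 (V2 & R2 & S2 & T2).
    assert (HW : 0 < INR (S w)) by (apply lt_0_INR; lia).
    set (q := INR (S w) / INR (S (S w))) in *.
    assert (Hq : 0 <= q <= 1 /\ INR (S w) = q * INR (S (S w))).
    { unfold q. rewrite (S_INR (S w)). split; [split|field; lra].
      - apply Rmult_le_pos; [lra|]. left; apply Rinv_0_lt_compat; lra.
      - apply Rmult_le_reg_r with (INR (S w) + 1); [lra|].
        unfold Rdiv; rewrite Rmult_assoc, Rinv_l; lra. }
    destruct Hq as [Hq Hq'].
    assert (0 <= q ^ length ts <= 1) as Hqn.
    { split; [now apply pow_le|]. rewrite <- (pow1 (length ts)). apply pow_incr; lra. }
    assert (0 <= pv k (residue st1)) as P1 by (apply pv_nonneg; [lia|now apply valid_residue]).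
    assert (R1' : pv k (residue st1) <= q * pv k (residue st)).
    { apply Rmult_le_reg_l with (INR (S (S w))); [apply lt_0_INR; lia|].
      rewrite Hq' in R1. lra. }
    apply Hkont. split; [auto|split; [|split]].
    + apply Rle_trans with (1 := R2). simpl. rewrite (Rmult_comm q), Rmult_assoc.
      apply Rmult_le_compat_l; tauto.
    + intros j Hj. specialize (S1 j Hj); specialize (S2 j Hj); lra.
    + intros t' [<-|Hin]; auto.
      apply Rle_trans with (pv k (residue st1)).
      * apply Rle_trans with (1 := R2). nra.
      * apply Rle_trans with (1 := T1). apply Rmult_le_compat_l; auto; lra.
Qed.
End Round.

(** * Convergence of the residue and correctness of the recursion *)

(** Every [S w] rounds at least halve the residue, and [L] halvings outweigh the factor [S w]. *)
Lemma pow_ratio_le w : (S w <= 2 ^ L)%nat ->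
  INR (S w) * (INR (S w) / INR (S (S w))) ^ (S w * L) <= 1.
Proof.
  intros HL. rewrite pow_mult.
  assert (HW : 0 < INR (S w)) by (apply lt_0_INR; lia).
  set (q := INR (S w) / INR (S (S w))).
  assert (Hq : 0 < q) by (apply Rmult_lt_0_compat; [|apply Rinv_0_lt_compat, lt_0_INR]; auto; lia).
  (* Bernoulli: [(1 + 1/W)^W >= 2] *)
  assert (H2 : q ^ S w <= / 2).
  { assert (2 <= (/ q) ^ S w).
    { replace (/ q) with (1 + / INR (S w)).
      - apply Rle_trans with (1 + INR (S w) * / INR (S w)).
        + rewrite Rinv_r; lra.
        + apply poly. now apply Rinv_0_lt_compat.
      - unfold q. rewrite (S_INR (S w)). field. lra. }
    rewrite <- (Rinv_inv (q ^ S w)), <- pow_inv.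
    apply Rinv_le_contravar; lra. }
  assert (H3 : (q ^ S w) ^ L <= (/ 2) ^ L).
  { apply pow_incr. split; auto. apply pow_le; lra. }
  assert (H4 : INR (S w) <= 2 ^ L).
  { apply le_INR in HL. now rewrite pow_INR in HL. }
  apply Rle_trans with (2 ^ L * (/ 2) ^ L).
  - apply Rmult_le_compat; auto; [lra|]. apply pow_le, pow_le; lra.
  - rewrite <- Rpow_mult_distr, Rinv_r, pow1; lra.
Qed.

(** Induction on [k] for all [w], since the call for the previous agent asks for one more bundle;
    [k + w] stays unchanged. *)
Lemma solve_spec k w l : (k + w < n)%nat -> (n <= 2 ^ L)%nat -> Forall wf l ->
  implements (cost k w) (solve k w l) (fun AB => partial k w l (fst AB) (snd AB) []).
Proof.
  revert w l; induction k as [|k IH]; intros w l Hn HL Hl kont b Hkont.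
  - simpl. apply equal_cut_spec; auto; [lia|]. intros F [HF1 HF2]. apply Hkont.
    unfold partial; cbn [fst snd]. split; [|split; [|split]].
    + now rewrite app_nil_r.
    + intros; lia.
    + intros; lia.
    + intros j j' Hj Hj'. now rewrite !HF2.
  - assert (Hsub : forall m, Forall wf m -> implements (cost k (S w)) (solve k (S w) m)
        (fun AB => partial k (S w) m (fst AB) (snd AB) [])).
    { intros m Hm. apply IH; auto; lia. }
    assert (Hkn : (S k < n)%nat) by lia.
    cbn [solve cost].
    replace ((S w + S w * L) * (cost k (S w) + S w * S n) + w * S n + b)%nat with
      (length (seq 0 (S w)) * (cost k (S w) + S w * S n) +
       (length (repeat 0%nat (S w * L)) * (cost k (S w) + S w * S n) + (w * S n + b)))%nat
      by (rewrite length_seq, repeat_length; ring).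
    apply (rounds_spec k w l); auto.
    { apply Forall_forall. intros x. rewrite in_seq. lia. }
    { unfold valid, partial, alloc, bundles, residue; cbn [fst snd].
      assert (E : forall m, cat m (fun _ => []) = []) by (induction m; simpl; [auto|now rewrite IHm]).
      rewrite !E. split; [apply refines_refl|].
      split; [|split]; intros; simpl; lra. }
    intros st1 (V1 & _ & _ & T1).
    apply (rounds_spec k w l); auto.
    { apply Forall_forall. intros x Hx. apply repeat_spec in Hx. lia. }
    intros st2 (V2 & R2 & S2 & _).
    pose proof (valid_residue k w l Hl _ V1) as W1.
    pose proof (valid_residue k w l Hl _ V2) as W2.
    assert (HW : 0 < INR (S w)) by (apply lt_0_INR; lia).
    (* The first phase bounds the residue by [S w] times the slack; the second divides the residue
       by at least [S w], cancelling that factor. *)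
    assert (Hdom : forall j, (j <= w)%nat -> pv k (residue st2) <= slack k st2 j).
    { intros j Hj. apply Rmult_le_reg_l with (INR (S w)); auto.
      apply Rle_trans with (pv k (residue st1)).
      - rewrite repeat_length in R2.
        assert (0 <= pv k (residue st1)) by (apply pv_nonneg; auto; lia).
        pose proof (pow_ratio_le w ltac:(lia)).
        apply Rle_trans with (INR (S w) * ((INR (S w) / INR (S (S w))) ^ (S w * L)
                                * pv k (residue st1))).
        + apply Rmult_le_compat_l; auto; lra.
        + rewrite <- Rmult_assoc. nra.
      - apply Rle_trans with (INR (S w) * slack k st1 j).
        + apply T1. rewrite in_seq. lia.
        + apply Rmult_le_compat_l; auto; lra. }
    destruct st2 as [[A D] R0].
    unfold valid, slack, alloc, bundles, residue in *; cbn [fst snd] in *.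
    destruct V2 as (Vr & Vl & Ve & Vq).
    apply equal_cut_spec; auto. intros E [HE1 HE2]. apply Hkont. cbn [fst snd].
    assert (HR0 : forall i, (i < n)%nat -> 0 <= pv i R0) by (intros; apply pv_nonneg; auto).
    assert (HE3 : Forall wf (cat (S w) E)) by (apply (proj1 HE1); auto).
    (* The shares [E] are equal only for agent [S k]; to agent [k] one of them may be worth up to
       the whole residue. *)
    assert (HEle : forall j, (j <= w)%nat -> pv k (E j) <= pv k R0).
    { intros j Hj. destruct HE1 as (_ & H & _). rewrite <- (H k) by lia.
      assert (forall m, (j < m)%nat -> (m <= S w)%nat -> pv k (E j) <= pv k (cat m E)) as HH.
      { induction m as [|m IHm]; intros; [lia|]. simpl. rewrite pv_app.
        assert (forall x, Forall wf x -> 0 <= pv k x) as Hpos by (intros; apply pv_nonneg; auto; lia).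
        assert (Forall wf (E m)) by (apply (Forall_cat _ _ _ HE3); lia).
        destruct (Nat.eq_dec j m) as [->|].
        - assert (Forall wf (cat m E)).
          { clear - HE3 H1. apply Forall_forall. intros x.
            rewrite cat_flat_map, in_flat_map. intros (y & Hy & Hx). rewrite in_seq in Hy.
            assert (Forall wf (E y)) as Hf by (apply (Forall_cat _ _ _ HE3); lia).
            rewrite Forall_forall in Hf; auto. }
          pose proof (Hpos _ H3). lra.
        - pose proof (Hpos _ H2). assert (pv k (E j) <= pv k (cat m E)) by (apply IHm; lia). lra. }
      apply HH; lia. }
    split; [|split; [|split]].
    + apply refines_trans with (1 := Vr). rewrite app_nil_r.
      apply refines_app; [apply refines_refl|].
      apply refines_trans with (cat (S w) D ++ cat (S w) E).
      * apply refines_app; auto using refines_refl.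
      * apply refines_perm, Permutation_sym, cat_app.
    + auto.
    + intros i j [= ->] Hj. rewrite !pv_app. destruct (Ve k j eq_refl Hj).
      specialize (Hdom j Hj). specialize (HEle j Hj).
      assert (0 <= pv (S k) (E j)).
      { apply pv_nonneg; auto. apply (Forall_cat _ _ _ HE3); lia. }
      lra.
    + intros j j' Hj Hj'. now rewrite !pv_app, (Vq j j'), !HE2.
Qed.
End Protocol.

(** * From unordered pieces to a list of cuts and owners *)

Definition labels (n : nat) (F : nat -> piece) : list (atom * nat) :=
  flat_map (fun j => map (fun a => (a, j)) (F j)) (seq 0 n).

Definition arranged (n : nat) (F : nat -> piece) (l : list (atom * nat)) : Prop :=
  Permutation (labels n F) l /\ tiling 0 (map fst l) 1.

(** Ordering the atoms depends only on data already known and takes no query, so [epsilon] may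
    choose the order. *)
Definition announce (n : nat) (F : nat -> piece) : protocol :=
  let l := epsilon (inhabits []) (arranged n F) in
  Output (0 :: map (fun p => hi (fst p)) l) (map snd l).

Definition line_protocol (n : nat) : protocol :=
  eval_agents n 0 1 (fun f =>
    solve n (S (Nat.log2 n)) (n - 1) 0 [Atom 0 1 f] (fun AB =>
      announce n (upd (fst AB) (n - 1) (snd AB 0%nat)))).

(** Order-independent counterpart of [piece_val], which carries the values through the
    rearrangement. *)
Definition labelled_val (i j : nat) (l : list (atom * nat)) : R :=
  fold_right (fun p s => (if Nat.eqb (snd p) j then val (fst p) i else 0) + s) 0 l.

Lemma labelled_val_perm i j l l' :
  Permutation l l' -> labelled_val i j l = labelled_val i j l'.
Proof. induction 1; simpl; lra. Qed.

Lemma labelled_val_app i j l l' :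
  labelled_val i j (l ++ l') = labelled_val i j l + labelled_val i j l'.
Proof. induction l as [|a l IH]; simpl; [lra|rewrite IH; lra]. Qed.

Lemma labelled_val_map i j o l :
  labelled_val i j (map (fun a => (a, o)) l) = if Nat.eqb o j then pv i l else 0.
Proof. induction l as [|a l IH]; simpl; destruct (Nat.eqb o j); simpl in *; lra. Qed.

Lemma labels_S n F : labels (S n) F = labels n F ++ map (fun a => (a, n)) (F n).
Proof. unfold labels. rewrite seq_S, flat_map_app. simpl. now rewrite app_nil_r. Qed.

Lemma labelled_val_labels i j n F :
  labelled_val i j (labels n F) = if Nat.ltb j n then pv i (F j) else 0.
Proof.
  induction n as [|n IH]; [reflexivity|].
  rewrite labels_S, labelled_val_app, labelled_val_map, IH.
  destruct (Nat.eqb_spec n j) as [->|].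
  - rewrite Nat.ltb_irrefl. destruct (Nat.ltb_spec j (S j)); [lra|lia].
  - destruct (Nat.ltb_spec j n), (Nat.ltb_spec j (S n)); try lia; lra.
Qed.

Lemma map_fst_labels n F : map fst (labels n F) = cat n F.
Proof.
  induction n as [|n IH]; [reflexivity|].
  rewrite labels_S, map_app, IH, map_map, map_id. reflexivity.
Qed.

Lemma labels_owner n F : Forall (fun p => (snd p < n)%nat) (labels n F).
Proof.
  apply Forall_forall. intros p. unfold labels. rewrite in_flat_map.
  intros (j & Hj & Hp). rewrite in_map_iff in Hp. destruct Hp as (a & <- & _).
  rewrite in_seq in Hj. simpl; lia.
Qed.

Lemma arranged_ex n F : tileable (cat n F) -> exists l, arranged n F l.
Proof.
  intros (m & Hm & Ht). rewrite <- map_fst_labels in Hm. apply Permutation_sym in Hm.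
  apply Permutation_map_inv in Hm as (l & -> & Hl). exists l; split; auto.
Qed.

Lemma tiling_last (l : list (atom * nat)) x y : tiling x (map fst l) y ->
  last (x :: map (fun p => hi (fst p)) l) 0 = y.
Proof.
  revert x; induction l as [|p l IH]; intros x; simpl; auto.
  intros [_ H]. exact (IH _ H).
Qed.

Lemma tiling_sorted n v (l : list (atom * nat)) x y : Forall (wf n v) (map fst l) ->
  tiling x (map fst l) y -> Sorted Rle (x :: map (fun p => hi (fst p)) l).
Proof.
  revert x; induction l as [|p l IH]; intros x Hw Ht; simpl in *; [repeat constructor|].
  inversion Hw as [|? ? (_ & Hp & _) Hw']; subst. destruct Ht as [<- Ht].
  constructor; [auto|now constructor].
Qed.

(** In a tiling each segment starts where the previous one ends, so the right ends carry all the
    cuts. *)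
Lemma tiling_piece_val n v (l : list (atom * nat)) x y i j :
  (i < n)%nat -> Forall (wf n v) (map fst l) -> tiling x (map fst l) y ->
  piece_val (v i) j (x :: map (fun p => hi (fst p)) l) (map snd l) = labelled_val i j l.
Proof.
  intros Hi; revert x; induction l as [|p l IH]; intros x Hw Ht; simpl in *; auto.
  inversion Hw as [|? ? (_ & _ & _ & Hp) Hw']; subst. destruct Ht as [<- Ht].
  rewrite (Hp i Hi). f_equal. apply (IH _ Hw' Ht).
Qed.

Lemma announce_spec n v F b : tileable (cat n F) -> Forall (wf n v) (cat n F) ->
  (forall i, (S i < n)%nat ->
     pv i (F (S i)) <= pv i (F i) /\ pv (S i) (F i) <= pv (S i) (F (S i))) ->
  succeeds n line_graph v (announce n F) b.
Proof.
  intros Ht Hw Hlef. unfold announce.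
  pose proof (epsilon_spec (inhabits []) (arranged n F) (arranged_ex n F Ht)) as Hl.
  set (l := epsilon (inhabits []) (arranged n F)) in *; clearbody l.
  destruct Hl as [Hp Hl].
  assert (Hwl : Forall (wf n v) (map fst l)).
  { rewrite <- map_fst_labels in Hw. eapply Permutation_Forall; [|exact Hw].
    now apply Permutation_map. }
  assert (Hval : forall i j, (i < n)%nat -> (j < n)%nat ->
    piece_val (v i) j (0 :: map (fun p => hi (fst p)) l) (map snd l) = pv i (F j)).
  { intros i j Hi Hj. rewrite (tiling_piece_val n v l 0 1 i j Hi Hwl Hl).
    rewrite <- (labelled_val_perm i j _ _ Hp), labelled_val_labels.
    now destruct (Nat.ltb_spec j n); [|lia]. }
  constructor.
  - split; [simpl; now rewrite !length_map|].
    split; [reflexivity|]. split; [now apply tiling_last|].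
    split; [now apply (tiling_sorted n v) with 1|].
    apply Forall_map. eapply Permutation_Forall; [exact Hp|]. apply labels_owner.
  - intros i j Hi Hj [-> | ->]; rewrite !Hval by auto; apply Rle_ge; apply Hlef; auto.
Qed.

Lemma line_protocol_spec n v : (1 <= n)%nat -> (forall i, (i < n)%nat -> is_valuation (v i)) ->
  succeeds n line_graph v (line_protocol n) (n + cost n (S (Nat.log2 n)) (n - 1) 0).
Proof.
  intros Hn Hv. unfold line_protocol.
  assert (HL : (n <= 2 ^ S (Nat.log2 n))%nat) by (destruct (Nat.log2_spec n); lia).
  apply (eval_agents_spec n v n 0 1); [lia|lra|lra|lra|]. intros f Hf.
  assert (Hw : Forall (wf n v) [Atom 0 1 f]).
  { repeat constructor; simpl; auto; lra. }
  rewrite <- (Nat.add_0_r (cost _ _ _ _)).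
  apply (solve_spec n (S (Nat.log2 n)) v Hv (n - 1) 0 [Atom 0 1 f]); auto; [lia|].
  intros [A B] ((Hr & _ & Ht) & Hl & He & _); cbn [fst snd] in *.
  (* For [w = 0] the last agent has the single bundle [B 0], stored at index [n - 1]. *)
  assert (E : cat n (upd A (n - 1) (B 0%nat)) = cat (n - 1) A ++ cat 1 B ++ []).
  { destruct n as [|k]; [lia|]. replace (S k - 1)%nat with k by lia.
    cbn [cat]. rewrite upd_eq, app_nil_r. f_equal. apply cat_ext. intros; apply upd_neq; lia. }
  apply announce_spec.
  - rewrite E, <- (app_nil_r (_ ++ _)). apply Ht.
    exists [Atom 0 1 f]. simpl; auto.
  - rewrite E; auto.
  - intros i Hi. rewrite (upd_neq A _ _ i) by lia.
    destruct (Nat.eq_dec (S i) (n - 1)) as [E'|Hne].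
    + rewrite E', upd_eq, <- E'. destruct (He i 0%nat E' (le_n _)) as [H1 H2].
      rewrite <- E' in H2. auto.
    + rewrite upd_neq by auto. apply Hl; lia.
Qed.

(** * Bounding the number of queries by a power *)

(** Each level costs a factor [3 * n * S L]: there are at most [n * S L] rounds, and the trimmings
    and the final division fit in the remaining factor 3. *)
Lemma cost_le n L k w : (k + w < n)%nat ->
  (cost n L k w <= S n * (3 * n * S L) ^ S k)%nat.
Proof.
  revert w; induction k as [|k IH]; intros w H.
  - cbn [cost]. rewrite Nat.pow_1_r. nia.
  - cbn [cost]. specialize (IH (S w) ltac:(lia)).
    set (K := (3 * n * S L)%nat) in *.
    assert (HK : (1 <= K ^ S k)%nat).
    { change 1%nat with (S 0). apply Nat.neq_0_lt_0, Nat.pow_nonzero. unfold K; nia. }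
    assert (Hn : (n <= K ^ S k)%nat).
    { rewrite Nat.pow_succ_r'. assert (K ^ k <> 0)%nat by (apply Nat.pow_nonzero; unfold K; nia).
      unfold K at 1; nia. }
    rewrite (Nat.pow_succ_r' K (S k)).
    set (T := (K ^ S k)%nat) in *; clearbody T.
    set (c := cost n L k (S w)) in *; clearbody c.
    assert (Hm : (S w + S w * L <= n * S L)%nat) by nia.
    assert (H1 : (c + S w * S n <= S n * (2 * T))%nat) by nia.
    assert (H2 : ((S w + S w * L) * (c + S w * S n) <= n * S L * (S n * (2 * T)))%nat)
      by (apply Nat.mul_le_mono; auto).
    assert (H3 : (w * S n <= n * S L * (S n * T))%nat).
    { assert (w <= n * S L * T)%nat by nia. nia. }
    unfold K. nia.
Qed.

(** One further power of the base absorbs the factor [n + 1] and the [n] initial evaluations. *)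
Lemma total_cost_le n : (1 <= n)%nat ->
  (n + cost n (S (Nat.log2 n)) (n - 1) 0 <= (3 * n * (Nat.log2 n + 2)) ^ S n)%nat.
Proof.
  intros Hn. pose proof (cost_le n (S (Nat.log2 n)) (n - 1) 0 ltac:(lia)) as H.
  replace (S (n - 1)) with n in H by lia.
  replace (S (S (Nat.log2 n))) with (Nat.log2 n + 2)%nat in H by lia.
  rewrite Nat.pow_succ_r'. set (K := (3 * n * (Nat.log2 n + 2))%nat) in *.
  assert (HK : (1 <= K ^ n)%nat).
  { change 1%nat with (S 0). apply Nat.neq_0_lt_0, Nat.pow_nonzero. unfold K; nia. }
  set (T := (K ^ n)%nat) in *; clearbody T.
  assert (n + S n * T <= 3 * n * T)%nat by nia.
  unfold K. nia.
Qed.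

(** * Asymptotics of the exponent *)

(** The excess of the query bound is of order [log log n / log n]; the cruder inverse square root
    avoids nested logarithms. The constant is 24 + 1, from the two estimates in
    [total_cost_Rpower]. *)
Definition line_eps (n : nat) : R := 25 / sqrt (INR (Nat.log2 n)).

Lemma line_eps_cv : Un_cv line_eps 0.
Proof.
  intros e He.
  destruct (INR_unbounded ((25 / e) ^ 2)) as [q Hq].
  (* Beyond [2 ^ q] the logarithm is at least [q], which exceeds [(25 / e) ^ 2]. *)
  exists (2 ^ q)%nat. intros m Hm. unfold R_dist, line_eps.
  assert (Hlog : (q <= Nat.log2 m)%nat).
  { rewrite <- (Nat.log2_pow2 q) by lia. now apply Nat.log2_le_mono. }
  apply le_INR in Hlog.
  assert (H25 : 0 < 25 / e) by (apply Rdiv_lt_0_compat; lra).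
  assert (Hs : 25 / e < sqrt (INR (Nat.log2 m))).
  { rewrite <- (sqrt_pow2 (25 / e)) by lra. apply sqrt_lt_1; try lra; [apply pow_le; lra|apply pos_INR]. }
  rewrite Rminus_0_r, Rabs_pos_eq by (apply Rlt_le, Rdiv_lt_0_compat; lra).
  apply Rmult_lt_reg_r with (sqrt (INR (Nat.log2 m))); [lra|].
  unfold Rdiv at 1. rewrite Rmult_assoc, Rinv_l by lra.
  apply (Rmult_lt_compat_r e) in Hs; auto.
  replace (25 / e * e) with 25 in Hs by (field; lra). lra.
Qed.

Lemma ln_le_compat x y : 0 < x -> x <= y -> ln x <= ln y.
Proof. intros Hx [H| ->]; [left; now apply ln_increasing|lra]. Qed.

Lemma ln_le_id x : 0 < x -> ln x <= x.
Proof.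
  intros Hx. rewrite <- (ln_exp x) at 2. apply Rlt_le, ln_increasing; auto.
  pose proof (exp_ineq1 x). lra.
Qed.

(** The logarithm of the base is [ln n] plus a term at most of order [sqrt (log2 n)], which is small
    against [ln n]. *)
Lemma total_cost_Rpower n : (2 <= n)%nat ->
  INR ((3 * n * (Nat.log2 n + 2)) ^ S n) <= Rpower (INR n) ((1 + line_eps n) * INR n).
Proof.
  intros Hn. unfold line_eps.
  set (m := Nat.log2 n).
  assert (Hm : (1 <= m)%nat) by (apply (Nat.log2_le_mono 2 n); auto).
  assert (Hmn : (m < n)%nat) by (apply Nat.log2_lt_lin; lia).
  assert (Hpow : (2 ^ m <= n)%nat) by (apply Nat.log2_spec; lia).
  clearbody m.
  assert (Rm : 1 <= INR m) by (apply (le_INR 1); auto).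
  assert (Rn : 2 <= INR n) by (apply (le_INR 2); auto).
  assert (Rmn : INR m <= INR n) by (apply le_INR; lia).
  rewrite pow_INR, !mult_INR, plus_INR.
  replace (INR 3) with 3 by (simpl; lra). replace (INR 2) with 2 by (simpl; lra).
  set (M := INR m) in *; set (N := INR n) in *.
  set (r := sqrt M).
  assert (Hr : 1 <= r) by (unfold r; rewrite <- sqrt_1; apply sqrt_le_1; lra).
  assert (Hrr : r * r = M) by (apply sqrt_sqrt; lra).
  assert (HlnN : M / 2 <= ln N).
  { apply Rle_trans with (ln (2 ^ m)).
    - rewrite ln_pow by lra. fold M. pose proof ln_lt_2. nra.
    - apply ln_le_compat; [apply pow_lt; lra|]. apply le_INR in Hpow. now rewrite pow_INR in Hpow. }
  (* Here [M + 2 <= 3 * (r * r)] because [r >= 1]; then [ln x <= x] is used at [x = 3 * r]. *)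
  assert (Hg : ln (3 * (M + 2)) <= 6 * r).
  { apply Rle_trans with (ln ((3 * r) * (3 * r))).
    - apply ln_le_compat; nra.
    - rewrite ln_mult by lra. pose proof (ln_le_id (3 * r)). lra. }
  assert (HP : 0 < 3 * N * (M + 2)) by nra.
  rewrite <- Rpower_pow by auto. unfold Rpower.
  assert (Hexp : INR (S n) * ln (3 * N * (M + 2)) <= (1 + 25 / r) * N * ln N).
  { replace (3 * N * (M + 2)) with (N * (3 * (M + 2))) by ring.
    rewrite ln_mult by lra. rewrite S_INR; fold N.
    assert (HrM : M / r = r) by (rewrite <- Hrr; field; lra).
    assert (Hi : 0 < / r <= 1).
    { split; [apply Rinv_0_lt_compat; lra|]. rewrite <- Rinv_1. apply Rinv_le_contravar; lra. }
    assert (Hl0 : 0 < ln N) by lra.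
    (* [24/r] pays for the logarithmic factor, [1/r >= 1/N] for the extra power of [N] *)
    assert (H1 : (N + 1) * ln (3 * (M + 2)) <= 24 / r * N * ln N).
    { apply Rle_trans with (2 * N * (6 * r)).
      - apply Rle_trans with ((N + 1) * (6 * r)); [apply Rmult_le_compat_l; lra|].
        apply Rmult_le_compat_r; lra.
      (* Writing [r] as [M / r] brings in [M / 2 <= ln N]. *)
      - replace (2 * N * (6 * r)) with (24 * N * (M / r / 2)) by (rewrite HrM; field).
        unfold Rdiv in *.
        assert (M * / r * / 2 <= / r * ln N) by nra.
        nra. }
    assert (H2 : ln N <= / r * N * ln N).
    { assert (1 <= / r * N).
      { apply Rmult_le_reg_l with r; [lra|]. rewrite <- Rmult_assoc, Rinv_r by lra. nra. }
      nra. }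
    unfold Rdiv in *. nra. }
  destruct Hexp as [Hlt|Heq]; [left; now apply exp_increasing|rewrite Heq; lra].
Qed.

Theorem theorem1 :
  exists (P : nat -> protocol) (eps : nat -> R),
    Un_cv eps 0 /\
    forall (n : nat), (1 <= n)%nat ->
    forall (v : nat -> R -> R -> R),
      (forall i, (i < n)%nat -> is_valuation (v i)) ->
      exists b : nat,
        INR b <= Rpower (INR n) ((1 + eps n) * INR n) /\
        succeeds n line_graph v (P n) b.
Proof.
  exists line_protocol, line_eps. split; [exact line_eps_cv|].
  intros n Hn v Hv. exists (n + cost n (S (Nat.log2 n)) (n - 1) 0)%nat. split.
  (* For one agent [line_eps] divides by zero, but [ln 1 = 0] makes the bound 1, which equals the
     query count. *)
  - destruct (Nat.eq_dec n 1) as [->|].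
    + simpl. unfold Rpower. rewrite ln_1, Rmult_0_r, exp_0. lra.
    + eapply Rle_trans; [apply le_INR, total_cost_le; lia|]. apply total_cost_Rpower; lia.
  - now apply line_protocol_spec.
Qed.
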